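(* Suppose that $\mu>\lambda\ge\theta\ge\kappa$ are infinite cardinals. Then the following are equivalent: (A) There is a family $\mathcal{P}^*$ of $\mu$ subsets of $\lambda$, each of power $\le\kappa$ (none of whose subfamilies of size $\mu$ has a transversal, but) whose every subfamily of size $<\theta$ is discrete. (B) There is a regular ideal $J$ on $\kappa$, and a family $\mathcal{F}^*$ of $\mu$ many functions from $\kappa$ to $\lambda$ such that for every subfamily $\mathcal{F}$ of $\mathcal{F}^*$ with $|\mathcal{F}|<\theta$ there is a sequence $\langle s_f:f\in\mathcal{F}\rangle$ of sets in $J$ such that for all distinct $f,g\in\mathcal{F}$ \[ i\in\kappa\setminus(s_f\cap s_g)\implies f(i)\neq g(i), \] but there is no such sequence for any subfamily of $\mathcal{F}^*$ which has size $\mu$. Moreover, if $\mathcal{F}\subseteq\mathcal{F}^*$ is of size $\ge\lambda^+$, there is no sequence $\langle s_f:f\in\mathcal{F}\rangle$ of sets in $J$ such that for all distinct $f,g\in\mathcal{F}$ \[ i\in\kappa\setminus(s_f\cup s_g)\implies f(i)\neq g(i). \]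
   Context: A non-empty family $\mathcal{F}$ of non-empty sets is discrete iff there is a choice function $f$ on $\mathcal{F}$ (i.e. $f(F)\in F$ for all $F\in\mathcal{F}$) such that for all $F_0\ne F_1$ in $\mathcal{F}$, $f(F_0)\notin F_1$; such an $f$ is called a discretisation of $\mathcal{F}$. Discreteness is required of non-empty subfamilies. A transversal of a family of sets is a one-to-one choice function on it. Ideals are proper; an ideal $J$ on $\kappa$ is regular (in the standard sense) iff there are sets $A_\zeta\in J$ ($\zeta<\kappa$) such that each $i<\kappa$ belongs to $\kappa\setminus A_\zeta$ for only finitely many $\zeta<\kappa$. *)

(* Defs.v *)
From mathcomp Require Import all_boot.
From mathcomp Require Import boolp classical_sets functions cardinality.
From mathcomp Require wochoice.

Set Implicit Arguments.
Unset Strict Implicit.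
Unset Printing Implicit Defensive.

Local Open Scope classical_set_scope.
Local Open Scope card_scope.

(* A cardinal is represented by a type [T] of that cardinality, through its
   full set [set: T]; cardinals are compared by injections ([#<=]) and
   identified up to bijection ([#=]). *)

Definition card_lt T U (A : set T) (B : set U) : Prop :=
  A #<= B /\ ~ (B #<= A).

(* [S] represents the successor cardinal of [L]: the least cardinal strictly
   above that of [L].  Such an [S] exists by [card_succ_exists]. *)
Definition is_card_succ (L S : Type) : Prop :=
  card_lt [set: L] [set: S] /\
  forall U : Type, card_lt [set: L] [set: U] -> [set: S] #<= [set: U].

(* Only the values of the total function [c] on [F] matter. *)
Definition choice_function T (F : set (set T)) (c : set T -> T) : Prop :=
  forall A, F A -> A (c A).

Definition discretisation T (F : set (set T)) (c : set T -> T) : Prop :=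
  choice_function F c /\
  forall A0 A1, F A0 -> F A1 -> A0 <> A1 -> ~ A1 (c A0).

Definition discrete_family T (F : set (set T)) : Prop :=
  [/\ F !=set0, (forall A, F A -> A !=set0) & exists c, discretisation F c].

Definition transversal T (F : set (set T)) (c : set T -> T) : Prop :=
  choice_function F c /\
  forall A0 A1, F A0 -> F A1 -> c A0 = c A1 -> A0 = A1.

Definition has_transversal T (F : set (set T)) : Prop :=
  exists c, transversal F c.

Record proper_ideal K (J : set (set K)) : Prop := ProperIdeal {
  ideal_set0 : J set0;
  ideal_subset : forall A B, A `<=` B -> J B -> J A;
  ideal_setU : forall A B, J A -> J B -> J (A `|` B);
  ideal_proper : ~ J [set: K]
}.

Definition regular_ideal K (J : set (set K)) : Prop :=
  exists A : K -> set K,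
    (forall z, J (A z)) /\ forall i, finite_set [set z | (~` A z) i].

(* The sequence <s_f : f in F> of sets in J is a total function whose values
   outside [F] are irrelevant. *)
Definition separatedI K L (J : set (set K)) (F : set (K -> L)) : Prop :=
  exists s : (K -> L) -> set K,
    (forall f, F f -> J (s f)) /\
    forall f g, F f -> F g -> f <> g ->
      forall i, (~` (s f `&` s g)) i -> f i <> g i.

Definition separatedU K L (J : set (set K)) (F : set (K -> L)) : Prop :=
  exists s : (K -> L) -> set K,
    (forall f, F f -> J (s f)) /\
    forall f g, F f -> F g -> f <> g ->
      forall i, (~` (s f `|` s g)) i -> f i <> g i.

Lemma card_leTTP T U :
  [set: T] #<= [set: U] <-> exists f : T -> U, injective f.
Proof.
split=> [/card_leP[f]|[f fI]].
  exists (fun x => val (f (to_setT x))) => x y /val_inj.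
  move=> /('inj_f) - /(_ (in_setT _) (in_setT _)) exy.
  by have := congr1 val exy.
apply/card_leP/injfunPex; exists (fun x => to_setT (f (val x))) => // x y _ _.
by move=> /(congr1 val)/fI/val_inj.
Qed.

Local Lemma sval_injective T (P : T -> Prop) : injective (@sval T P).
Proof. by move=> [x px] [y py] /= exy; exact: eq_exist. Qed.

Section CardSucc.
Variables (T : Type) (lt : T -> T -> Prop).
Hypothesis lt_wf : well_founded lt.
Hypothesis lt_tot : forall x y, [\/ x = y, lt x y | lt y x].

Let wf_embed U : (exists f : T -> U, injective f) \/
  exists x (g : U -> {y | lt y x}), injective g.
Proof.
have [H|/existsNP[x /existsNP[g gP]]] := pselect
    (forall x (g : {y | lt y x} -> U), exists u, forall y, g y <> u).
  left; pose F x (g : forall y, lt y x -> U) : U :=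
    sval (cid (H x (fun y => g (sval y) (svalP y)))).
  pose f := Fix lt_wf _ F.
  have fE x : f x = F x (fun y _ => f y).
    rewrite /f Fix_eq// => z g h gh; congr F.
    by apply: functional_extensionality_dep => y; apply: funext.
  have fP x y : lt y x -> f y <> f x.
    by move=> yx; rewrite [f x]fE /F; case: cid => u /= /(_ (exist _ y yx)).
  exists f => x y fxy; case: (lt_tot x y) => // /fP; by rewrite fxy.
right; exists x.
have gS u : exists y, g y = u.
  by apply: contrapT => /forallNP gu; apply: gP; exists u.
by exists (fun u => sval (cid (gS u))) => u v; do 2 case: cid => ? /= <-; move=> ->.
Qed.

Lemma wf_card_succ L : ~ ([set: T] #<= [set: L]) ->
  (forall x, [set: {y | lt y x}] #<= [set: L]) -> is_card_succ L T.
Proof.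
move=> TL segL; split.
  split=> //; apply/card_leTTP; case: (wf_embed L) => [/card_leTTP//|[x [g gI]]].
  by exists (fun u => sval (g u)) => u v /sval_injective/gI.
move=> U [_ UL]; case: (wf_embed U) => [/card_leTTP//|[x [g gI]]].
by case: UL; apply: card_le_trans (segL x); apply/card_leTTP; exists g.
Qed.

End CardSucc.

Lemma card_succ_exists L : exists S : Type, is_card_succ L S.
Proof.
pose M : eqType := {classic (set L)}.
have [R Rwo] := wochoice.well_ordering_principle M.
pose lt (x y : M) := R x y /\ x <> y.
have Rmin (A : set M) : A !=set0 ->
    exists2 z, A z & forall y, A y -> R z y.
  move=> [x Ax].
  have [|z [[zA zmin] _]] := Rwo (mem A); first by exists x; rewrite inE.
  exists z; first by move: zA; rewrite inE.
  by move=> y Ay; apply: zmin; rewrite inE.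
have Rasym : antisymmetric R.
  have Rxx x : R x x.
    by have [|z -> ->] := Rmin [set x]; first by exists x.
  move=> x y /andP[Rxy Ryx].
  have [|z [_ zu]] := Rwo (mem [set x; y]); first by exists x; rewrite inE; left.
  rewrite -(zu x); last by split=> [|u]; rewrite inE; [left|case=> ->].
  by rewrite -(zu y)//; split=> [|u]; rewrite inE; [right|case=> ->].
have lt_tot x y : [\/ x = y, lt x y | lt y x].
  have [->|/eqP xy] := eqVneq x y; first exact: Or31.
  have [|z zxy zmin] := Rmin [set x; y]; first by exists x; left.
  have := zmin x (or_introl erefl); have := zmin y (or_intror erefl).
  case: zxy => -> Ry Rx; first exact: Or32.
  by apply: Or33; split=> // /esym.
have lt_wf : well_founded lt.
  move=> x; apply: contrapT => nAx.
  have [|z nAz zmin] := Rmin [set x | ~ Acc lt x]; first by exists x.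
  apply: nAz; constructor => y [Ryz yz]; apply: contrapT => /zmin Rzy.
  by apply: yz; apply: Rasym; rewrite Ryz Rzy.
have ML : ~ ([set: M] #<= [set: L]).
  move=> /card_leTTP[f fI]; pose D : set L := [set f A | A in [set A | ~ A (f A)]].
  have nD : ~ D (f D) by move=> /[dup] DfD [A nA /fI AD]; apply: nA; rewrite AD.
  by apply: (nD); exists D.
have [segL|/existsNP[x0 x0L]] :=
  pselect (forall x, [set: {y | lt y x}] #<= [set: L]).
  by exists M; exact: wf_card_succ lt_wf lt_tot L ML segL.
have [|x xL xmin] := Rmin [set x | ~ ([set: {y | lt y x}] #<= [set: L])].
  by exists x0.
exists {y | lt y x}.
refine (@wf_card_succ _ (fun u v => lt (sval u) (sval v)) _ _ L xL _).
- suff accS y : forall yx : lt y x, Acc (fun u v => lt (sval u) (sval v))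
      (exist (lt^~ x) y yx) by case.
  elim: (lt_wf y) => {}y _ IH yx; constructor => -[z zx] /= zy.
  exact: IH.
- move=> [u ux] [v vx] /=; case: (lt_tot u v) => [uv|uv|uv].
  + by apply: Or31; exact: eq_exist.
  + exact: Or32.
  + exact: Or33.
move=> [u [Rux ux]] /=; apply: (@card_le_trans _ _ _ [set: {y | lt y u}]).
  apply/card_leTTP; exists (fun v => exist (lt^~ u) (sval (sval v)) (svalP v)).
  move=> v w /(congr1 (@sval _ _)) vw.
  by apply: sval_injective; apply: sval_injective.
apply: contrapT => /xmin Rxu; apply: ux; apply: Rasym; rewrite Rux.
exact: Rxu.
Qed.

(* Main.v *)
Require Import Defs.
From mathcomp Require Import all_boot.
From mathcomp Require Import boolp classical_sets functions cardinality.

(* (B) => (A): identify [kappa * lam] with [lam] and take the graphs of the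
   functions; a discretisation picks a point of the graph of [f] outside [s f].
   (A) => (B): enumerate each [A] in the family as [a A : kappa -> lam], identify
   [kappa] with its finite sequences and put [f_A u = map (a A) u], modulo the
   ideal generated by the sets [{u | z \notin u}].  If [c] is a discretisation
   and [c A = a A z], then [u] outside [{u | z \notin u}] puts [c A], which is
   in no other [B], among the entries of [f_A u].  The ideal has [kappa]
   generators, so a family separated modulo it has at most [kappa * lam = lam]
   elements. *)

Set Implicit Arguments.
Unset Strict Implicit.

Local Open Scope classical_set_scope.
Local Open Scope card_scope.

(** * Comparing cardinals through injections and Zorn's lemma *)

Lemma card_le_rel T U (A : set T) (B : set U) (R : T -> U -> Prop) :
    (forall x, A x -> exists2 y, B y & R x y) ->
    (forall x x' y, A x -> A x' -> R x y -> R x' y -> x = x') ->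
  A #<= B.
Proof.
move=> RE RI; have [[x0 Ax0]|A0] := pselect (A !=set0); last first.
  have -> : A = set0 by apply: contrapT => /eqP/set0P.
  exact: card_ge0.
have [y0 _ _] := RE _ Ax0.
have /choice[f fP] : forall x, exists y, A x -> B y /\ R x y.
  move=> x; have [/RE[y By Rxy]|nAx] := pselect (A x); first by exists y.
  by exists y0.
elim/Ppointed: U => U in B R RE RI y0 f fP *; first by case: (no y0).
apply/pcard_leP/injfunPex; exists f => [x /fP[]//|x x' /set_mem Ax /set_mem Ax' ff].
apply: (RI _ _ (f x)) => //; first by have [] := fP _ Ax.
by rewrite ff; have [] := fP _ Ax'.
Qed.

Lemma card_le_fun T U (A : set T) (B : set U) (y0 : U) : A #<= B ->
  exists2 f : T -> U, (forall x, A x -> B (f x)) &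
    forall x x', A x -> A x' -> f x = f x' -> x = x'.
Proof.
elim/Ppointed: U => U in B y0 *; first by case: (no y0).
move=> /pcard_leP[f]; exists f => [x Ax|x x' Ax Ax' ff]; first exact: funS.
by apply: (@inj _ _ A f); rewrite ?inE.
Qed.

Lemma chain_common T (F : set (set T)) (p q : T) : total_on F subset ->
    (\bigcup_(X in F) X) p -> (\bigcup_(X in F) X) q ->
  exists X, [/\ F X, X p & X q].
Proof.
move=> totF [X FX Xp] [Y FY Yq].
have [XY|YX] := totF _ _ FX FY; first by exists Y; split=> //; exact: XY.
by exists X; split=> //; exact: YX.
Qed.

(** Injections with unspecified domain, encoded as graphs so that unions of chains can be taken in
    Zorn's lemma. *)
Definition partial_injection {T U} (G : set (T * U)) : Prop :=
  (forall x y y', G (x, y) -> G (x, y') -> y = y') /\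
  (forall x x' y, G (x, y) -> G (x', y) -> x = x').

Lemma partial_injection_bigcup T U (F : set (set (T * U))) :
    F `<=` partial_injection -> total_on F subset ->
  partial_injection (\bigcup_(X in F) X).
Proof.
move=> FI totF; split=> [x y y'|x x' y] p q;
  have [X [/FI[X1 X2] Xp Xq]] := chain_common totF p q.
- exact: X1 Xp Xq.
- exact: X2 Xp Xq.
Qed.

(** A maximal partial injection from [A] to [B] is defined on all of [A] or reaches all of [B]:
    otherwise a pair of missed points could be added. *)
Lemma card_le_total T U (A : set T) (B : set U) : A #<= B \/ B #<= A.
Proof.
pose P (G : set (T * U)) := G `<=` A `*` B /\ partial_injection G.
have [F FP totF|G [[GAB [Gf Gi]] Gmax]] := @Zorn_bigcup _ P.
  split; first by move=> p [X /FP[XAB _] /XAB].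
  by apply: partial_injection_bigcup => // X /FP[].
have [|/existsNP[a /not_implyP[Aa aG]]] :=
    pselect (forall x, A x -> exists y, G (x, y)).
  move=> dom; left; apply: (@card_le_rel _ _ A B (fun x y => G (x, y))).
    by move=> x /dom[y Gxy]; exists y => //; have [] := GAB _ Gxy.
  by move=> x x' y _ _; exact: Gi.
have [|/existsNP[b /not_implyP[Bb bG]]] :=
    pselect (forall y, B y -> exists x, G (x, y)).
  move=> ran; right; apply: (@card_le_rel _ _ B A (fun y x => G (x, y))).
    by move=> y /ran[x Gxy]; exists x => //; have [] := GAB _ Gxy.
  by move=> y y' x _ _; exact: Gf.
case: (Gmax (G `|` [set (a, b)])).
  split; first exact: subsetUl.
  by move=> GU; apply: aG; exists b; apply: GU; right.
split; first by move=> p [/GAB//|->].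
split=> [x y y'|x x' y] [p|[p q]] [r|[r s]]; rewrite ?p ?q ?r ?s //.
- exact: Gf p r.
- by case: aG; exists y; rewrite -r.
- by case: aG; exists y'; rewrite -p.
- exact: Gi p r.
- by case: bG; exists x; rewrite -s.
- by case: bG; exists x'; rewrite -q.
Qed.

(** * Squares and finite sequences over an infinite set *)

Section Square.
Variable T : Type.
Implicit Types (G : set (T * T * T)) (A : set T) (f : T * T -> T).

(** The diagonal of a graph on [A * A] recovers [A], so the graph alone carries its base set through
    unions of chains. *)
Definition base G : set T := [set x | exists z, G (x, x, z)].

Definition square_injection G : Prop :=
  [/\ partial_injection G,
      forall x y, base G x -> base G y -> exists z, G (x, y, z) &
      forall x y z, G (x, y, z) -> [/\ base G x, base G y & base G z]].

Definition square_graph A f : set (T * T * T) :=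
  [set p | [/\ A p.1.1, A p.1.2 & p.2 = f p.1]].

Lemma base_square_graph A f : base (square_graph A f) = A.
Proof.
apply/seteqP; split=> [x [z []]//|x Ax]; by exists (f (x, x)); split.
Qed.

Lemma square_graph_injection A f :
    (forall x y, A x -> A y -> A (f (x, y))) ->
    (forall x y x' y', A x -> A y -> A x' -> A y' ->
      f (x, y) = f (x', y') -> (x, y) = (x', y')) ->
  square_injection (square_graph A f).
Proof.
move=> fA fI; split; rewrite ?base_square_graph.
- split=> [[x y] z z' [/= _ _ ->] [/= _ _ ->]//|].
  by move=> [x y] [x' y'] z [/= ? ? ->] [/= ? ?]; exact: fI.
- by move=> x y Ax Ay; exists (f (x, y)).
- by move=> x y z [/= Ax Ay ->]; split=> //; exact: fA.
Qed.

Lemma square_injection_bigcup (F : set (set (T * T * T))) :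
    F `<=` square_injection -> total_on F subset ->
  square_injection (\bigcup_(X in F) X).
Proof.
move=> FI totF.
have baseF X x : F X -> base X x -> base (\bigcup_(X in F) X) x.
  by move=> FX [z Xz]; exists z; exists X.
split; first by apply: partial_injection_bigcup => // X /FI[].
- move=> x y [z p] [z' q].
  have [X [FX Xp Xq]] := chain_common totF p q.
  have [_ /(_ x y) Xt _] := FI _ FX.
  have [||w Xw] := Xt; [by exists z|by exists z'|by exists w; exists X].
- move=> x y z [X FX Xp]; have [_ _ /(_ _ _ _ Xp)[? ? ?]] := FI _ FX.
  by split; exact: (baseF X).
Qed.

(* By maximality the complement of the base [A] of a maximal injection
   [A * A -> A] embeds in [A]: otherwise [A] embeds in its complement, and the
   three pieces of [(A + A)^2 - A^2] fit in the second copy of [A]. *)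
Lemma infinite_square : infinite_set [set: T] ->
  exists f : T * T -> T, injective f.
Proof.
move=> /infiniteP/card_leTTP[e eI].
pose A0 := range e.
have /choice[e' e'K] : forall x, exists n, A0 x -> x = e n.
  move=> x; have [[n _ <-]|nA] := pselect (A0 x); first by exists n.
  by exists 0.
pose f0 (p : T * T) := e (pickle (e' p.1, e' p.2)).
pose G0 := square_graph A0 f0.
have G0P : square_injection G0.
  apply: square_graph_injection => [x y _ _|x y x' y']; first by eexists.
  move=> /e'K xE /e'K yE /e'K x'E /e'K y'E /eI/(pcan_inj (@pickleK _))[Ex Ey].
  by rewrite xE yE x'E y'E Ex Ey.
pose P G := G = set0 \/ G0 `<=` G /\ square_injection G.
have [F FP totF|G [GP Gmax]] := @Zorn_bigcup _ P.
  have [[X FX [p Xp]]|F0] := pselect (exists2 X, F X & X !=set0); last first.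
    by left; apply: bigcup0 => X FX; apply: contrapT => /eqP/set0P X0;
       apply: F0; exists X.
  right; pose F' := [set X | F X /\ X !=set0].
  have FF' : \bigcup_(X in F) X = \bigcup_(X in F') X.
    apply/seteqP; split=> q [Y]; last by move=> [FY _] Yq; exists Y.
    by move=> FY Yq; exists Y => //; split=> //; exists q.
  have F'P Y : F' Y -> G0 `<=` Y /\ square_injection Y.
    by move=> [/FP[->|//]] [].
  split.
    move=> q G0q; exists X => //; have [|G0X _] := F'P X; last exact: G0X.
    by split=> //; exists p.
  rewrite FF'; apply: square_injection_bigcup => [Y /F'P[]//|].
  by move=> Y Z [FY _] [FZ _]; exact: totF.
have [G0G [[Gf Gi] Gt Gb]] : G0 `<=` G /\ square_injection G.
  case: GP => // GE; exfalso; case: (Gmax G0); last by right; split.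
  rewrite GE; split=> // /(_ (e 0, e 0, f0 (e 0, e 0))); apply.
  by split=> //=; exists 0.
pose A := base G.
have Ae n : A (e n).
  by exists (f0 (e n, e n)); apply: G0G; split=> //=; exists n.
have /choice[f fP] : forall p, exists z, A p.1 -> A p.2 -> G (p, z).
  move=> [x y]; have [[Ax Ay]|nA] := pselect (A x /\ A y).
    by have [z Gz] := Gt _ _ Ax Ay; exists z.
  by exists (e 0) => /= Ax Ay; case: nA.
have fA x y : A x -> A y -> A (f (x, y)).
  by move=> Ax Ay; have [] := Gb _ _ _ (fP (x, y) Ax Ay).
have fI x y x' y' : A x -> A y -> A x' -> A y' ->
    f (x, y) = f (x', y') -> x = x' /\ y = y'.
  move=> Ax Ay Ax' Ay' ff; suff [-> ->] : (x, y) = (x', y') by [].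
  apply: (Gi _ _ (f (x, y))); first exact: fP.
  by rewrite ff; exact: fP.
have [/(card_le_fun (e 0))[h hA hI]|/(card_le_fun (e 0))[h hA hI]] :=
    card_le_total (~` A) A.
  (* [g] injects [T] into [A], the labels [e 0] and [e 1] keeping [A] and its complement apart. *)
  have /choice[g gP] : forall x, exists y, A y /\
      (A x /\ y = f (e 0, x) \/ (~` A) x /\ y = f (e 1, h x)).
    move=> x; have [Ax|nAx] := pselect (A x).
      by exists (f (e 0, x)); split; [exact: fA|left].
    by exists (f (e 1, h x)); split; [apply: (fA) => //; exact: hA|right].
  have gA x : A (g x) by have [] := gP x.
  have gI : injective g.
    move=> x y; have [_ [[Ax ->]|[nAx ->]]] := gP x;
      have [_ [[Ay ->]|[nAy ->]]] := gP y; (case/fI; [by auto..|]) => // /eI //.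
    by move=> _; exact: hI.
  exists (fun p => f (g p.1, g p.2)) => -[x y] [x' y'] /= /fI[]//.
  by move=> /gI -> /gI ->.
exfalso.
pose B := h @` A.
have BA x : B x -> ~ A x by move=> [y Ay <-]; exact: hA.
have /choice[r rP] : forall x, exists y, [/\ A x -> y = x, B x -> h y = x &
    A x \/ B x -> A y].
  move=> x; have [Ax|nAx] := pselect (A x).
    by exists x; split=> // /BA.
  have [[y Ay yx]|nBx] := pselect (B x); first by exists y; split.
  by exists x; split=> // -[].
pose A' := A `|` B.
have rA x : A' x -> A (r x) by have [_ _] := rP x.
have rI x y : (A x <-> A y) -> A' x -> A' y -> r x = r y -> x = y.
  have [rx1 rx2 _] := rP x; have [ry1 ry2 _] := rP y.
  move=> [xy yx] [Ax|Bx].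
    by move=> _; rewrite rx1// ry1//; exact: xy.
  move=> [Ay|By]; first by case: (BA _ Bx); exact: yx.
  by move=> rxy; rewrite -(rx2 Bx) rxy ry2.
(* The labels 0, 1, 2 mark the new pieces [A * B], [B * A] and [B * B]. *)
pose tag (p : T * T) := e (if `[< A p.1 >] then 0 else if `[< A p.2 >] then 1 else 2).
have tagA p : A (tag p) by rewrite /tag; exact: Ae.
have tagI x y x' y' : ~ (A x /\ A y) -> ~ (A x' /\ A y') ->
    tag (x, y) = tag (x', y') -> (A x <-> A x') /\ (A y <-> A y').
  rewrite /tag /= => n n' /eI.
  by repeat (case: asboolP => ?) => //; tauto.
(* Old pairs keep their value in [A]; new pairs are coded inside [A] and then moved by [h] into [B],
   so old and new values cannot collide. *)
pose f' (p : T * T) := if `[< A p.1 /\ A p.2 >] then f p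
  else h (f (tag p, f (r p.1, r p.2))).
have f'A x y : A' x -> A' y -> ~ (A x /\ A y) -> A (f (tag (x, y), f (r x, r y))).
  by move=> Ax Ay _; apply: (fA) => //; apply: (fA); exact: rA.
have G'P : square_injection (square_graph A' f').
  apply: square_graph_injection => [x y A'x A'y|x y x' y' A'x A'y A'x' A'y'].
    rewrite /f' /=; case: asboolP => [[Ax Ay]|nA]; first by left; exact: fA.
    by right; eexists; [|reflexivity]; exact: f'A.
  rewrite /f' /=; case: asboolP => [[Ax Ay]|nA];
    case: asboolP => [[Ax' Ay']|nA'].
  - by move=> /fI[]// -> ->.
  - move=> fh; have [] : (~` A) (f (x, y)) by rewrite fh; apply: hA; exact: f'A.
    exact: fA.
  - move=> fh; have [] : (~` A) (f (x', y')) by rewrite -fh; apply: hA; exact: f'A.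
    exact: fA.
  - have rrA u v : A' u -> A' v -> A (f (r u, r v)).
      by move=> A'u A'v; apply: fA; exact: rA.
    move=> /(hI _ _ (f'A _ _ A'x A'y nA) (f'A _ _ A'x' A'y' nA')).
    move=> /(fI _ _ _ _ (tagA _) (rrA _ _ A'x A'y) (tagA _) (rrA _ _ A'x' A'y')).
    move=> [/(tagI _ _ _ _ nA nA')[xx yy]].
    move=> /(fI _ _ _ _ (rA _ A'x) (rA _ A'y) (rA _ A'x') (rA _ A'y'))[].
    by move=> /(rI _ _ xx A'x A'x') -> /(rI _ _ yy A'y A'y') ->.
have GG' : G `<=` square_graph A' f'.
  move=> [[x y] z] Gp; have [Ax Ay _] := Gb _ _ _ Gp.
  split; [by left|by left|]; rewrite /f' /= asboolT//.
  by apply: Gf Gp _; exact: fP.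
case: (Gmax (square_graph A' f')); last first.
  by right; split=> // p /G0G/GG'.
split=> // G'G.
have [] : ~ A (h (e 0)) by exact: hA.
exists (f' (h (e 0), h (e 0))); apply: G'G.
by split=> //=; right; exists (e 0).
Qed.
End Square.

(** A sequence is folded into one element by repeated pairing; its length is coded too, since it
    tells where unpairing stops. *)
Lemma infinite_seq T : infinite_set [set: T] ->
  exists code : seq T -> T, injective code.
Proof.
move=> T_inf; have [f fI] := infinite_square T_inf.
have [e eI] := (card_leTTP _ _).1 ((infiniteP _).1 T_inf).
pose enc := foldr (fun x t => f (x, t)) (e 0).
exists (fun s => f (e (size s), enc s)) => s s' /fI[/eI].
elim: s s' => [|x s IH] [|x' s']//= [ss'] /fI[-> ?].
by congr cons; exact: IH.
Qed.

(** * Products, enumerations and transfer of sizes *)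

Lemma card_le_prod_inj K L : infinite_set [set: L] -> [set: K] #<= [set: L] ->
  exists f : K * L -> L, injective f.
Proof.
move=> /infinite_square[f fI] /card_leTTP[h hI].
by exists (fun p => f (h p.1, p.2)) => -[x y] [x' y'] /fI /= [/hI -> ->].
Qed.

Lemma card_le_enum T K (A : set T) : A !=set0 -> A #<= [set: K] ->
  exists a : K -> T, range a = A.
Proof.
move=> [x0 Ax0] /[dup]/card_leP[h0].
have k0 : K := val (h0 (SigSub (mem_set Ax0))).
move=> /(card_le_fun k0)[h _ hI].
(* [a] inverts [h] on the image of [A]; other indices get the default [x0]. *)
have /choice[a aP] : forall k, exists x, A x /\ (forall y, A y -> h y = k -> x = y).
  move=> k; have [[x Ax xk]|nk] := pselect (exists2 x, A x & h x = k).
    by exists x; split=> // y Ay yk; apply: hI => //; rewrite xk.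
  by exists x0; split=> // y Ay yk; case: nk; exists y.
exists a; apply/seteqP; split=> [_ [k _ <-]|x Ax]; first by have [] := aP k.
by exists (h x) => //; have [_ /(_ x)] := aP (h x); apply.
Qed.

Lemma card_lt_eql T U V (A : set T) (B : set U) (C : set V) :
  A #= B -> card_lt B C -> card_lt A C.
Proof. by move=> AB [BC CB]; rewrite /card_lt (card_le_eql AB) (card_le_eqr AB). Qed.

Lemma card_lt_finite T U (A : set T) (B : set U) :
  finite_set A -> infinite_set B -> card_lt A B.
Proof.
move=> A_fin B_inf; split.
  by apply: card_le_trans ((infiniteP _).1 B_inf); exact: finite_set_countable.
by move=> /card_le_finite/(_ A_fin).
Qed.

(** Pulls a subfamily of an image back to an equally large family of arguments, so that hypotheses
    on small subfamilies transfer. *)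
Lemma card_eq_preimage T U (f : T -> U) (P : set T) (Q : set U) :
    {in P &, injective f} -> Q `<=` f @` P ->
  Q #= (P `&` f @^-1` Q).
Proof.
move=> fI QP; have QE : Q = f @` (P `&` f @^-1` Q).
  apply/seteqP; split=> [y /[dup] Qy /QP[x Px xy]|y [x [_ ? <-]]//].
  by exists x => //; split=> //=; rewrite xy.
rewrite {1}QE; apply: inj_card_eq => x y; rewrite !inE => -[Px _] [Py _].
by apply: fI; rewrite inE.
Qed.

(** * Separation modulo an ideal *)

Lemma separatedI_separatedU K L (J : set (set K)) (F : set (K -> L)) :
  separatedI J F -> separatedU J F.
Proof.
move=> [s [sJ sF]]; exists s; split=> // f g Ff Fg fg i nU.
by apply: sF => // -[sf _]; apply: nU; left.
Qed.

(* Transporting along [d : K ->> seq K] the ideal on finite sets generated by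
   the sets [{u | z \notin u}]. *)
Section FiniteIdeal.
Variables (K : eqType) (d : K -> seq K).
Hypothesis d_surj : forall w, exists i, d i = w.

Definition finite_ideal : set (set K) :=
  [set S | exists w : seq K, forall i, S i -> ~~ all (mem (d i)) w].

Definition missing (z : K) : set K := [set i | z \notin d i].

Lemma finite_ideal_missing z : finite_ideal (missing z).
Proof. by exists [:: z] => i /=; rewrite andbT. Qed.

Lemma proper_finite_ideal : proper_ideal finite_ideal.
Proof.
split=> [|A B AB [w wB]|A B [v vA] [w wB]|[w wT]].
- by exists [::].
- by exists w => i /AB; exact: wB.
- exists (v ++ w) => i; rewrite all_cat negb_and.
  by move=> [/vA ->//|/wB ->]; rewrite orbT.
(* An index decoding to [w] itself escapes all the generators listed by [w]. *)
- have [i iw] := d_surj w; have := wT i I.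
  by rewrite iw; case/negP; apply/allP.
Qed.

(** [i] lies outside [missing z] only when [z] is one of the finitely many entries of [d i]. *)
Lemma regular_finite_ideal : regular_ideal finite_ideal.
Proof.
exists missing; split=> [z|i]; first exact: finite_ideal_missing.
apply: sub_finite_set (finite_seq (d i)) => z /= /negP.
by rewrite negbK.
Qed.

(* If [s f] avoids all [i] with [w f] contained in [d i], then
   [f |-> (w f, f i)], with [d i = w f], is injective on a separated family. *)
Lemma separatedU_card_le L (F : set (K -> L)) :
    infinite_set [set: L] -> [set: K] #<= [set: L] ->
  separatedU finite_ideal F -> F #<= [set: L].
Proof.
move=> L_inf /(card_le_prod_inj L_inf)[pr prI] [s [sJ sF]].
have /choice[i iP] : forall f, exists i, F f ->
    forall j, d j = d i -> ~ s f j.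
  move=> f; have [Ff|nF] := pselect (F f); last first.
    by have [i _] := d_surj [::]; exists i.
  have [w wP] := sJ _ Ff; have [i iw] := d_surj w; exists i => _ j ji /wP.
  by rewrite ji iw => /negP; apply; apply/allP.
apply: (@card_le_rel _ _ _ _ (fun f y => y = pr (i f, f (i f)))).
  by move=> f _; eexists.
(* Equal codes mean that [f] and [g] share their index and agree there, although it lies outside
   both [s f] and [s g]. *)
move=> f g _ Ff Fg -> /prI[ifg]; rewrite -ifg => fg; apply: contrapT => nfg.
apply: (sF _ _ Ff Fg nfg (i f)) fg; case=> /=; first exact: iP.
by apply: iP => //; rewrite ifg.
Qed.

End FiniteIdeal.

(** * Passing between discrete and separated families *)

Section Families.
Variables (mu theta : Type) (lam kappa : eqType).
Hypothesis lam_inf : infinite_set [set: lam].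
Hypothesis kappa_inf : infinite_set [set: kappa].
Hypothesis theta_inf : infinite_set [set: theta].
Hypothesis le_kappa_lam : [set: kappa] #<= [set: lam].

(** The final bound on [separatedU] subfamilies yields both negative clauses of (B), for size [mu]
    and for size at least the successor of [lam]. *)
Lemma discrete_to_separated (P : set (set lam)) :
    P #= [set: mu] -> (forall A, P A -> A #<= [set: kappa]) ->
    (forall Q, Q `<=` P -> Q !=set0 -> card_lt Q [set: theta] ->
       discrete_family Q) ->
  exists (J : set (set kappa)) (Fs : set (kappa -> lam)),
     [/\ proper_ideal J /\ regular_ideal J,
         Fs #= [set: mu],
         forall F, F `<=` Fs -> card_lt F [set: theta] -> separatedI J F
       & forall F, F `<=` Fs -> separatedU J F -> F #<= [set: lam]].
Proof.
move=> P_mu P_le P_disc.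
have [codeK codeKI] := infinite_seq kappa_inf.
have [code codeI] := infinite_seq lam_inf.
have /choice[d dK] : forall i, exists w, forall v, codeK v = i -> w = v.
  move=> i; have [[w <-]|nw] := pselect (exists w, codeK w = i).
    by exists w => v /codeKI.
  by exists [::] => v vi; case: nw; exists v.
have d_surj w : exists i, d i = w by exists (codeK w); exact: dK.
(* A singleton is smaller than the infinite [theta], and its discreteness includes that its member
   is non-empty. *)
have P_ne A : P A -> A !=set0.
  move=> PA; have [|||_ + _] := P_disc [set A]; last exact.
  - by move=> _ ->.
  - by exists A.
  - by apply: card_lt_finite => //; exact: finite_set1.
have /choice[a aP] : forall A, exists a : kappa -> lam, P A -> range a = A.
  move=> A; have [PA|nPA] := pselect (P A).
    by have [a] := card_le_enum (P_ne _ PA) (P_le _ PA); exists a.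
  by have [x] := infinite_setN0 lam_inf; exists (fun=> x).
pose fn A i := code (map (a A) (d i)).
have fnI : {in P &, injective fn}.
  move=> A B; rewrite !inE => PA PB /funeqP fAB.
  rewrite -(aP _ PA) -(aP _ PB); suff -> : a A = a B by [].
  apply/funext => z.
  have [i iz] := d_surj [:: z].
  by have := fAB i; rewrite /fn iz => /codeI[].
exists (finite_ideal d), (fn @` P); split.
- by split; [exact: proper_finite_ideal|exact: regular_finite_ideal].
- exact: card_eq_trans (inj_card_eq fnI) P_mu.
(* The empty family is treated apart, as discreteness is given for non-empty subfamilies only. *)
- move=> F FP F_lt; have [[f0 Ff0]|F0] := pselect (F !=set0); last first.
    exists (fun=> set0); split; first by move=> f Ff; case: F0; exists f.
    by move=> f g Ff; case: F0; exists f.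
  pose Q := P `&` fn @^-1` F.
  have [|||_ _ [c [cQ cD]]] := P_disc Q.
  + by move=> A [].
  + by have [A PA Af] := FP _ Ff0; exists A; split=> //=; rewrite Af.
  + by apply: card_lt_eql F_lt; apply: card_esym; exact: card_eq_preimage.
  have /choice[z zP] : forall f, exists z, F f ->
      exists2 A, Q A & fn A = f /\ a A z = c A.
    move=> f; have [Ff|nF] := pselect (F f); last first.
      by have [z] := infinite_setN0 kappa_inf; exists z.
    have [A PA Af] := FP _ Ff; have QA : Q A by split=> //=; rewrite Af.
    by have := cQ _ QA; rewrite -{1}(aP _ PA) => -[z _ zA]; exists z => _; exists A.
  exists (fun f => missing d (z f)); split=> [f _|f g Ff Fg fg i].
    exact: finite_ideal_missing.
  (* If the two sequences were equal, [c A] would be an entry of [map (a B) w], hence a point of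
     [B]. *)
  have hit A B (w : seq kappa) x : Q A -> Q B -> A <> B -> x \in w ->
      a A x = c A -> map (a A) w <> map (a B) w.
    move=> QA QB AB xw xA wAB; apply: (cD _ _ QA QB AB); rewrite -xA.
    have := map_f (a A) xw; rewrite wAB => /mapP[y _ ->].
    by rewrite -[X in X _](aP _ QB.1); exists y.
  have [A QA [Af zA]] := zP _ Ff; have [B QB [Bg zB]] := zP _ Fg.
  have AB : A <> B by move=> AB; apply: fg; rewrite -Af -Bg AB.
  (* Outside the intersection, [z f] or [z g] occurs in [d i], and either one suffices for [hit]. *)
  move=> /not_andP nI; suff : fn A i <> fn B i by rewrite Af Bg.
  case: nI => /negP/negPn zi /codeI.
  + exact: (hit _ _ _ _ QA QB AB zi zA).
  + by move/esym; exact: (hit _ _ _ _ QB QA (nesym AB) zi zB).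
- by move=> F _; exact: separatedU_card_le.
Qed.

Lemma separated_to_discrete (J : set (set kappa)) (Fs : set (kappa -> lam)) :
    proper_ideal J -> Fs #= [set: mu] ->
    (forall F, F `<=` Fs -> card_lt F [set: theta] -> separatedI J F) ->
  exists P : set (set lam),
     [/\ P #= [set: mu],
         forall A, P A -> A #<= [set: kappa]
       & forall Q, Q `<=` P -> Q !=set0 -> card_lt Q [set: theta] ->
           discrete_family Q].
Proof.
move=> J_ideal Fs_mu Fs_sep.
have [pr prI] := card_le_prod_inj lam_inf le_kappa_lam.
pose graph (f : kappa -> lam) := range (fun i => pr (i, f i)).
have graphP f i x : graph f (pr (i, x)) -> f i = x.
  by move=> [j _ /prI[-> ->]].
have graphI : injective graph.
  move=> f g fg; apply/funext => i; apply: esym; apply: graphP.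
  by rewrite -fg; exists i.
exists (graph @` Fs); split.
- apply: card_eq_trans Fs_mu; apply: inj_card_eq => f g _ _; exact: graphI.
- by move=> _ [f _ <-]; exact: card_image_le.
- move=> Q QP Q0 Q_lt; split=> //.
    move=> _ /QP[f _ <-]; have [i _] := infinite_setN0 kappa_inf.
    by exists (pr (i, f i)); exists i.
  pose F := Fs `&` graph @^-1` Q.
  have [||s [sJ sF]] := Fs_sep F; first by move=> f [].
    apply: card_lt_eql Q_lt; apply: card_esym; apply: card_eq_preimage => //.
    by move=> f g _ _; exact: graphI.
  have /choice[c cP] : forall A, exists x, Q A ->
      exists f i, [/\ F f, graph f = A, ~ s f i & x = pr (i, f i)].
    move=> A; have [QA|nQA] := pselect (Q A); last first.
      by have [x] := infinite_setN0 lam_inf; exists x.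
    have [f Ff fA] := QP _ QA; have FF : F f by split=> //=; rewrite fA.
    (* Properness of [J] leaves an index outside [s f]. *)
    have /existsNP[i isf] : ~ (forall i, s f i).
      move=> sT; apply: (ideal_proper J_ideal).
      by apply: (ideal_subset J_ideal) (sJ _ FF) => i _; exact: sT.
    by exists (pr (i, f i)) => _; exists f, i.
  exists c; split=> [A QA|A B QA QB AB].
    by have [f [i [_ <- _ ->]]] := cP _ QA; exists i.
  have [f [i [Ff fA si ->]]] := cP _ QA; have [g [_ [Fg gB _ _]]] := cP _ QB.
  (* An index outside [s f] is outside [s f] intersected with any [s g], so [f] and [g] cannot agree
     there. *)
  rewrite -gB => /graphP fg.
  apply: (sF _ _ Ff Fg _ i) (esym fg); first by move=> E; apply: AB; rewrite -fA -gB E.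
  by case.
Qed.

End Families.

Unset Implicit Arguments.

Theorem theorem4p3 (mu lam theta kappa : Type)
    (mu_inf : infinite_set [set: mu]) (lam_inf : infinite_set [set: lam])
    (theta_inf : infinite_set [set: theta])
    (kappa_inf : infinite_set [set: kappa])
    (lt_lam_mu : card_lt [set: lam] [set: mu])
    (le_theta_lam : [set: theta] #<= [set: lam])
    (le_kappa_theta : [set: kappa] #<= [set: theta]) :
  (exists P : set (set lam),
     [/\ P #= [set: mu],
         forall A, P A -> A #<= [set: kappa],
         forall Q, Q `<=` P -> Q #= [set: mu] -> ~ has_transversal Q
       & forall Q, Q `<=` P -> Q !=set0 -> card_lt Q [set: theta] ->
           discrete_family Q])
  <->
  (exists (J : set (set kappa)) (Fs : set (kappa -> lam)),
     [/\ proper_ideal J /\ regular_ideal J,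
         Fs #= [set: mu],
         forall F, F `<=` Fs -> card_lt F [set: theta] -> separatedI J F,
         forall F, F `<=` Fs -> F #= [set: mu] -> ~ separatedI J F
       & forall lam_succ : Type, is_card_succ lam lam_succ ->
           forall F, F `<=` Fs -> [set: lam_succ] #<= F -> ~ separatedU J F]).
Proof.
have le_kappa_lam := card_le_trans le_kappa_theta le_theta_lam.
elim/Peq: lam => lam in lam_inf lt_lam_mu le_theta_lam le_kappa_lam *.
elim/Peq: kappa => kappa in kappa_inf le_kappa_theta le_kappa_lam *.
have not_mu_le_lam T (Q : set T) : Q #= [set: mu] -> ~ (Q #<= [set: lam]).
  by move=> Q_mu Q_lam; apply: lt_lam_mu.2; rewrite -(card_le_eql Q_mu).
split=> [[P [P_mu P_le _ P_disc]]|[J [Fs [[J_ideal _] Fs_mu Fs_sep _ _]]]].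
- have [J [Fs [J_reg Fs_mu Fs_sep Fs_le]]] :=
    discrete_to_separated lam_inf kappa_inf theta_inf le_kappa_lam P_mu P_le P_disc.
  exists J, Fs; split=> //.
    move=> F FFs F_mu /separatedI_separatedU/(Fs_le _ FFs).
    exact: not_mu_le_lam.
  move=> lam_succ [[_ n_succ_le] _] F FFs succ_le /(Fs_le _ FFs) F_le.
  by apply: n_succ_le; exact: card_le_trans F_le.
- have [P [P_mu P_le P_disc]] :=
    separated_to_discrete lam_inf kappa_inf le_kappa_lam J_ideal Fs_mu Fs_sep.
  (* A transversal would inject a family of size [mu] into [lam]. *)
  exists P; split=> // Q QP Q_mu [c [cQ cI]]; apply: (not_mu_le_lam _ Q Q_mu).
  apply: (@card_le_rel _ _ _ _ (fun A x => x = c A)); first by move=> A; eexists.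
  by move=> A B _ QA QB -> ; exact: cI.
Qed.
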